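(* Let $A(\nabla)=(a_1(\nabla),a_2(\nabla),a_3(\nabla))$ be any polynomial operator as in the context, let $\lambda_n$ be an eigenvalue and $\psi_n\in E_n$ a corresponding eigenfunction $(n=1,2,\dots)$ of the problem $-\Delta\psi=\lambda^2\psi$, $\psi(x+2\pi)=\psi(x)$ for all $x\in\mathbb{R}^3$, and let $$u_{ns}^n(t,x)=\lambda_ne^{-\nu\lambda_n^2t}A(\nabla)\psi_n(x)+e^{-\nu\lambda_n^2t}\{A(\nabla)\times\nabla\}\psi_n(x),$$ which is a solution of the incompressible Navier-Stokes equations with viscosity $\nu>0$ and periodic boundary condition. Let $\mu$ be a random number and $\Gamma_\mu$ the path on which $t\nu=\mu$ for any $(\nu,t)\in\Gamma_\mu$. Then: (i) one has the path limit $$\begin{aligned}u_e^{n,\mu}(x)&=\lim_{(\nu,t)\in\Gamma_\mu,\ (\nu,1/t)\to(0,0)}u_{ns}^n(t,x)\\&=\lambda_ne^{-\mu\lambda_n^2}A(\nabla)\psi_n(x)+e^{-\mu\lambda_n^2}\{A(\nabla)\times\nabla\}\psi_n(x)\\&=\lambda_nA(\nabla)\{e^{-\mu\lambda_n^2}\psi_n(x)\}+\{A(\nabla)\times\nabla\}\{e^{-\mu\lambda_n^2}\psi_n(x)\};\end{aligned}$$ (ii) the random $u=u_e^{n,\mu}$ is a solution of the static incompressible Euler equations $(u\cdot\nabla)u+\nabla P=0$, $\nabla\cdot u=0$ (with some scalar pressure $P$) with periodic boundary condition $u(x+2\pi)=u(x)$ for all $x\in\mathbb{R}^3$; (iii)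 on the other hand, the double limit $\lim_{(\nu,1/t)\to(0,0)}u_{ns}^n(t,x)$ does not exist. These phenomena reveal randomness and turbulence of incompressible fluids.
   Context: Here $x=(x_1,x_2,x_3)$, $\nabla=(\partial_1,\partial_2,\partial_3)$, $\partial_j=\partial/\partial x_j$; $f(x+2\pi)=f(x)$ means $f$ is $2\pi$-periodic in each of $x_1,x_2,x_3$. The Navier-Stokes equations are $u_t-\nu\Delta u+(u\cdot\nabla)u+\nabla P=0$, $\nabla\cdot u=0$. The operators $A(\nabla)$ are those of the form $(p_1(\nabla),p_2(\nabla),p_3(\nabla))$, where $p_1,p_2,p_3$ are polynomials with $x_1p_1(x)+x_2p_2(x)+x_3p_3(x)\equiv0$ for all $x\in\mathbb{R}^3$, and $p_j(\nabla)$ is obtained by substituting $\partial_k$ for $x_k$ (Fourier symbol $p_j(i\xi)$). The operator $A(\nabla)$ and the functions $\psi_n$ are real. Write $A(\nabla)\psi=(a_1(\nabla)\psi,a_2(\nabla)\psi,a_3(\nabla)\psi)$ and $$\{A(\nabla)\times\nabla\}\psi=\big((a_2(\nabla)\partial_3-a_3(\nabla)\partial_2)\psi,\ (a_3(\nabla)\partial_1-a_1(\nabla)\partial_3)\psi,\ (a_1(\nabla)\partial_2-a_2(\nabla)\partial_1)\psi\big).$$ The eigenvalues are $0\le\lambda_1\le\cdots\le\lambda_n\le\cdots$, and $E_n$ is the linear space of all eigenfunctions corresponding to $\lambda_n$.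
   Formalization: In (iii) the double limit is shown not to exist at each x where λ_nA(∇)ψ_n(x)+{A(∇)×∇}ψ_n(x)≠0; elsewhere u_ns vanishes at x and the limit is 0 (e.g. λ_1=0). The random number μ is taken positive, so that Γ_μ is nonempty for ν,t>0. *)

(* Defs.v *)
From HB Require Import structures.
From mathcomp Require Import all_boot all_order all_algebra.
From mathcomp Require Import all_classical all_reals all_analysis.
(* not Imported: its notations clash with those of mathcomp-analysis *)
From mathcomp Require mpoly.

Set Implicit Arguments.
Unset Strict Implicit.
Unset Printing Implicit Defensive.

Import Order.TTheory GRing.Theory Num.Theory.
Import numFieldNormedType.Exports.

Local Open Scope classical_set_scope.
Local Open Scope ring_scope.

(* A point of R^3 is a row vector; the coordinates x_1, x_2, x_3 are indexed by
   0, 1, 2 : 'I_3, and arithmetic on such indices is modulo 3. *)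

Section VectorCalculus.
Variable R : realType.

Definition scalar_field := 'rV[R]_3 -> R.
Definition vector_field := 'rV[R]_3 -> 'rV[R]_3.

Definition basis_vec (j : 'I_3) : 'rV[R]_3 := delta_mx ord0 j.

Definition partial (j : 'I_3) (f : scalar_field) : scalar_field :=
  fun x => 'D_(basis_vec j) f x.

Definition iter_partial (s : seq 'I_3) (f : scalar_field) : scalar_field :=
  foldr partial f s.

(* 'D_v f x is total, so the existence of each partial derivative is asserted
   separately. *)
Definition smooth (f : scalar_field) : Prop :=
  forall s : seq 'I_3,
    continuous (iter_partial s f) /\
    forall (j : 'I_3) (x : 'rV[R]_3), derivable (iter_partial s f) x (basis_vec j).

Definition component (u : vector_field) (j : 'I_3) : scalar_field :=
  fun x => u x ord0 j.

Definition smooth_field (u : vector_field) : Prop :=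
  forall j, smooth (component u j).

Definition periodic2pi (T : Type) (f : 'rV[R]_3 -> T) : Prop :=
  forall (x : 'rV[R]_3) (j : 'I_3), f (x + (2 * pi) *: basis_vec j) = f x.

Definition laplacian (f : scalar_field) : scalar_field :=
  fun x => \sum_(j < 3) partial j (partial j f) x.

Definition divergence (u : vector_field) : scalar_field :=
  fun x => \sum_(j < 3) partial j (component u j) x.

(* j-th component of (u . nabla) u *)
Definition advection (u : vector_field) (j : 'I_3) : scalar_field :=
  fun x => \sum_(k < 3) u x ord0 k * partial k (component u j) x.

Definition static_euler (u : vector_field) (p : scalar_field) : Prop :=
  [/\ smooth_field u,
      smooth p,
      forall x (j : 'I_3), advection u j x + partial j p x = 0
    & forall x, divergence u x = 0].

Definition navier_stokes (nu : R) (u : R -> vector_field)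
    (p : R -> scalar_field) : Prop :=
  forall t : R, 0 <= t ->
  [/\ smooth_field (u t),
      smooth (p t),
      forall x (j : 'I_3), derivable (fun s : R => u s x ord0 j) t 1,
      forall x (j : 'I_3),
        derive1 (fun s : R => u s x ord0 j) t - nu * laplacian (component (u t) j) x
          + advection (u t) j x + partial j (p t) x = 0
    & forall x, divergence (u t) x = 0].

Definition laplace_eigenspace (l : R) (psi : scalar_field) : Prop :=
  [/\ smooth psi,
      periodic2pi psi
    & forall x, - laplacian psi x = l ^+ 2 * psi x].

Definition laplace_eigenvalue (l : R) : Prop :=
  0 <= l /\ exists psi, laplace_eigenspace l psi /\ exists x, psi x <> 0.

(* lambda_1 <= lambda_2 <= ..., with lambda_{n+1} stored as lam n; repetitions
   according to multiplicity are allowed but not imposed. *)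
Definition eigenvalue_sequence (lam : nat -> R) : Prop :=
  {homo lam : m n / (m <= n)%N >-> m <= n} /\
  forall l : R, laplace_eigenvalue l <-> exists n, lam n = l.

(* The operator p(nabla), obtained by substituting d/dx_k for x_k in p. *)
Definition poly_op (p : mpoly.mpoly 3 R) (f : scalar_field) : scalar_field :=
  fun x => \sum_(m <- mpoly.msupp p)
    mpoly.mcoeff m p *
    iter (mpoly.fun_of_multinom m 0) (partial 0)
      (iter (mpoly.fun_of_multinom m 1) (partial 1)
        (iter (mpoly.fun_of_multinom m 2) (partial 2) f)) x.

(* x_1 p_1(x) + x_2 p_2(x) + x_3 p_3(x) = 0 for all x *)
Definition admissible (a : 'I_3 -> mpoly.mpoly 3 R) : Prop :=
  forall x : 'I_3 -> R, \sum_(j < 3) x j * mpoly.meval x (a j) = 0.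

Definition vec_op (a : 'I_3 -> mpoly.mpoly 3 R) (f : scalar_field) :
    vector_field :=
  fun x => \row_(j < 3) poly_op (a j) f x.

(* {A(nabla) x nabla} f; the indices j + 1 and j + 2 are taken modulo 3. *)
Definition cross_op (a : 'I_3 -> mpoly.mpoly 3 R) (f : scalar_field) :
    vector_field :=
  fun x => \row_(j < 3)
    (poly_op (a (j + 1)) (partial (j + 2) f) x
     - poly_op (a (j + 2)) (partial (j + 1) f) x).

Definition u_ns (a : 'I_3 -> mpoly.mpoly 3 R) (l : R) (psi : scalar_field)
    (nu t : R) : vector_field :=
  fun x => (l * expR (- (nu * l ^+ 2 * t))) *: vec_op a psi x
           + expR (- (nu * l ^+ 2 * t)) *: cross_op a psi x.

(* Pairs (nu, t) of a viscosity and a time. *)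
Definition quadrant : set (R * R) := [set q | 0 < q.1 /\ 0 < q.2].

Definition inviscid_path (mu : R) : set (R * R) := quadrant `&` [set q | q.2 * q.1 = mu].

(* (nu, t) in D with (nu, 1/t) -> (0, 0).  The limit is taken in the coordinates
   (nu, s) with s = 1/t, and transported to (nu, t) by (nu, s) |-> (nu, 1/s). *)
Definition inviscid (D : set (R * R)) : set_system (R * R) :=
  (fun q : R * R => (q.1, q.2^-1)) @
    within [set q : R * R | D (q.1, q.2^-1)] (nbhs (0 : R, 0 : R)).

Definition u_e (a : 'I_3 -> mpoly.mpoly 3 R) (l : R) (psi : scalar_field)
    (mu : R) : vector_field :=
  fun x => lim (u_ns a l psi q.1 q.2 x @[q --> inviscid (inviscid_path mu)]).

End VectorCalculus.

(* Main.v *)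
Require Import Defs.
From HB Require Import structures.
From mathcomp Require Import all_boot all_order all_algebra.
From mathcomp Require Import all_classical all_reals all_analysis.
From mathcomp Require mpoly.
From mathcomp Require Import measurable_realfun ring lra.
Import Order.TTheory GRing.Theory Num.Theory.
Import numFieldNormedType.Exports.
Local Open Scope classical_set_scope.
Local Open Scope ring_scope.

(** Put v_j = a_j(nabla) psi.  The condition on A(nabla) says that the
    polynomial x_1 a_1 + x_2 a_2 + x_3 a_3 has only zero values, so it is the
    zero polynomial ([mpoly_eq0_of_meval]) and div v = 0
    ([admissible_div_free]); moreover lap v = - lambda^2 v, because constant
    coefficient operators commute with the Laplacian ([laplacian_poly_op]).
    Since {A(nabla) x nabla} psi = - curl v, the field under study is
    W = lambda v - curl v.  From curl curl v = grad div v - lap v =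
    lambda^2 v follow curl W = - lambda W ([curl_beltrami]),
    lap W = - lambda^2 W ([laplacian_beltrami]) and div W = 0
    ([div_beltrami]).

    A field whose curl is parallel to it satisfies
    (W . nabla) W = grad (|W|^2 / 2), hence solves the static Euler equations
    with pressure - |W|^2 / 2 ([curl_eigen_static_euler]).  In the field
    u_ns = e^(- nu lambda^2 t) W the time derivative cancels the viscous term,
    and what remains is the static Euler equation of the field attached to the
    eigenfunction e^(- nu lambda^2 t) psi.

    On the path t nu = mu the field u_ns does not vary, so its limit there is
    e^(- mu lambda^2) W ([u_ns_path]).  A double limit would have to agree
    with the path limits for mu = 1 and mu = 2, which forces lambda = 0
    wherever W does not vanish.  For lambda = 0, psi is a periodic harmonic
    function; it is constant ([periodic_harmonic_cst]), and then W = 0.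

    The calculus behind this rests on two facts about smooth scalar fields:
    partial derivatives commute ([partialC]), and the pure second derivatives
    are nonpositive at a maximum ([partial2_max_le0]).  Both come from one mean
    value formula for second differences ([second_diffP]). *)

Set Implicit Arguments.
Unset Strict Implicit.
Unset Printing Implicit Defensive.

(** * Smooth scalar fields *)

Section Smooth.
Variable R : realType.
Implicit Types (f g : scalar_field R) (i j k : 'I_3) (x y : 'rV[R]_3).

(** The recursion removes the first derivative taken, whereas [iter_partial]
    exposes the last one; the product rule can only be iterated on the
    former. *)
Fixpoint classC (n : nat) (f : scalar_field R) : Prop :=
  [/\ continuous f, forall j x, derivable f x (basis_vec R j)
    & if n is n'.+1 then forall j, classC n' (partial j f) else True].

Lemma classC_continuous n f : classC n f -> continuous f.
Proof. by case: n => [|n] []. Qed.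

Lemma classC_derivable n f : classC n f -> forall j x, derivable f x (basis_vec R j).
Proof. by case: n => [|n] []. Qed.

Lemma classCS n f j : classC n.+1 f -> classC n (partial j f).
Proof. by case=> _ _; apply. Qed.

Lemma classCW n f : classC n.+1 f -> classC n f.
Proof.
elim: n f => [|n IH] f [cf df pf]; split=> // j.
exact/IH/pf.
Qed.

Lemma iter_partial_rcons s j f :
  iter_partial (rcons s j) f = iter_partial s (partial j f).
Proof. by rewrite /iter_partial foldr_rcons. Qed.

Lemma smoothP f : smooth f <-> forall n, classC n f.
Proof.
split=> [sf n|cf s].
  elim: n f sf => [|n IH] f sf; have [/= cf df] := sf [::]; split=> // j.
  by apply: IH => s; rewrite -iter_partial_rcons; exact: sf.
elim/last_ind: s f cf => [|s j IH] f cf.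
  by split; [exact: classC_continuous (cf 0%N) | exact: classC_derivable (cf 0%N)].
by rewrite iter_partial_rcons; apply: IH => n; apply: classCS.
Qed.

Lemma smooth_continuous f : smooth f -> continuous f.
Proof. by move=> /(_ [::])[]. Qed.

Lemma smooth_derivable f j x : smooth f -> derivable f x (basis_vec R j).
Proof. by move=> /(_ [::])[]. Qed.

Lemma smooth_partial f j : smooth f -> smooth (partial j f).
Proof. by move=> sf s; rewrite -iter_partial_rcons; exact: sf. Qed.

Lemma partialD f g j : (forall x, derivable f x (basis_vec R j)) ->
  (forall x, derivable g x (basis_vec R j)) ->
  partial j (f \+ g) = partial j f \+ partial j g.
Proof. by move=> df dg; apply/funext => x; rewrite /partial deriveD. Qed.

Lemma partialZ c f j : (forall x, derivable f x (basis_vec R j)) ->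
  partial j (c \*: f) = c \*: partial j f.
Proof. by move=> df; apply/funext => x; rewrite /partial deriveZ. Qed.

Lemma partialM f g j : (forall x, derivable f x (basis_vec R j)) ->
  (forall x, derivable g x (basis_vec R j)) ->
  partial j (f \* g) = (f \* partial j g) \+ (g \* partial j f).
Proof. by move=> df dg; apply/funext => x; rewrite /partial deriveM. Qed.

Lemma partial_cst c j : partial j (cst c) = cst 0 :> scalar_field R.
Proof. by apply/funext => x; rewrite /partial derive_cst. Qed.

Lemma classC_cst n c : classC n (cst c).
Proof.
elim: n c => [|n IH] c; split=> //; try by move=> ?; exact: cst_continuous.
by move=> j; rewrite partial_cst.
Qed.

Lemma classCD n f g : classC n f -> classC n g -> classC n (f \+ g).
Proof.
elim: n f g => [|n IH] f g [cf df pf] [cg dg pg]; split=> //;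
  try by move=> x; exact: (cvgD (cf x) (cg x)).
all: try by move=> j x; apply: derivableD.
by move=> j; rewrite partialD //; apply: IH; [exact: pf|exact: pg].
Qed.

(** The derivative f g' + g f' is a sum of products of fields of the next lower
    class, so [classCD] reduces the step to the induction hypothesis. *)
Lemma classCM n f g : classC n f -> classC n g -> classC n (f \* g).
Proof.
elim: n f g => [|n IH] f g /[dup] Hf [cf df pf] /[dup] Hg [cg dg pg]; split=> //;
  try by move=> x; exact: (cvgM (cf x) (cg x)).
all: try by move=> j x; apply: derivableM.
by move=> j; rewrite partialM //; apply: classCD;
  apply: IH; [exact: classCW|exact: pg|exact: classCW|exact: pf].
Qed.

Lemma smooth_cst c : smooth (cst c : scalar_field R).
Proof. by apply/smoothP => n; exact: classC_cst. Qed.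

Lemma smoothD f g : smooth f -> smooth g -> smooth (f \+ g).
Proof.
by move=> /smoothP sf /smoothP sg; apply/smoothP => n; exact: classCD.
Qed.

Lemma smoothM f g : smooth f -> smooth g -> smooth (f \* g).
Proof.
by move=> /smoothP sf /smoothP sg; apply/smoothP => n; exact: classCM.
Qed.

Lemma smoothZ c f : smooth f -> smooth (c \*: f).
Proof.
by move=> sf; apply: (smoothM (f := cst c)) => //; exact: smooth_cst.
Qed.

Lemma smooth_sum (I : Type) (r : seq I) (F : I -> scalar_field R) :
  (forall l, smooth (F l)) -> smooth (fun x => \sum_(l <- r) F l x).
Proof.
move=> sF; elim: r => [|l r IH].
  by under eq_fun do rewrite big_nil; exact: smooth_cst.
by under eq_fun do rewrite big_cons; apply: smoothD.
Qed.

Lemma partial_sum (I : Type) (r : seq I) (F : I -> scalar_field R) j :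
  (forall l, smooth (F l)) ->
  partial j (fun x => \sum_(l <- r) F l x)
    = fun x => \sum_(l <- r) partial j (F l) x.
Proof.
move=> sF; elim: r => [|l r IH].
  by under eq_fun do rewrite big_nil; rewrite partial_cst;
     under [RHS]eq_fun do rewrite big_nil.
under eq_fun do rewrite big_cons.
rewrite (@partialD (F l) (fun x => \sum_(l <- r) F l x)); last 2 first.
- by move=> x; exact: smooth_derivable.
- by move=> x; apply/smooth_derivable/smooth_sum.
by rewrite IH; apply/funext => x /=; rewrite big_cons.
Qed.

(** Reduction of directional derivatives to one real variable, so that the mean
    value theorem applies. *)
Lemma is_derive_line f x (v : 'rV[R]_3) (s : R) :
  derivable f (s *: v + x) v ->
  is_derive s (1 : R) (fun t : R => f (t *: v + x)) ('D_v f (s *: v + x)).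
Proof.
have E : (fun h : R => h^-1 *: (((fun t : R => f (t *: v + x)) \o shift s)
             (h *: (1 : R)) - f (s *: v + x)))
         = (fun h : R => h^-1 *: ((f \o shift (s *: v + x)) (h *: v)
             - f (s *: v + x))).
  apply/funext => h /=; rewrite addrA -scalerDl.
  by rewrite [h *: 1]mulr1.
by move=> df; apply: DeriveDef; rewrite /derivable /derive E.
Qed.

Lemma mvt_line f x j (h : R) : 0 < h ->
  (forall y, derivable f y (basis_vec R j)) ->
  exists2 s, 0 < s < h &
    f (h *: basis_vec R j + x) - f x
      = partial j f (s *: basis_vec R j + x) * h.
Proof.
move=> h0 df; set v := basis_vec R j.
have D s : is_derive s (1 : R) (fun t : R => f (t *: v + x))
             ('D_v f (s *: v + x)) by apply: is_derive_line; exact: df.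
have [|s sh E] := MVT (f := fun t : R => f (t *: v + x)) h0 (fun s _ => D s).
  apply: continuous_subspaceT => s.
  by apply/differentiable_continuous/derivable1_diffP; case: (D s).
exists s; first by move: sh; rewrite in_itv.
by move: E; rewrite scale0r add0r subr0.
Qed.

Definition second_diff f i j (h : R) x :=
  f (h *: basis_vec R i + (h *: basis_vec R j + x)) - f (h *: basis_vec R j + x)
  - (f (h *: basis_vec R i + x) - f x).

(** The mean value theorem is used twice: along e_i for
    z |-> f (h e_j + z) - f z, and then along e_j for the i-th derivative
    of f. *)
Lemma second_diffP f i j (h : R) x : smooth f -> 0 < h ->
  exists st : R * R, [/\ 0 < st.1 < h, 0 < st.2 < h &
    second_diff f i j h x =
      partial j (partial i f)
        (st.2 *: basis_vec R j + (st.1 *: basis_vec R i + x)) * h ^+ 2].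
Proof.
move=> sf h0; set ei := basis_vec R i; set ej := basis_vec R j.
pose g y := f (h *: ej + y) - f y.
have shift_der k y : derivable (fun z => f (h *: ej + z)) y (basis_vec R k)
    /\ 'D_(basis_vec R k) (fun z => f (h *: ej + z)) y
       = partial k f (h *: ej + y).
  have E : (fun t : R => t^-1 *: (((fun z => f (h *: ej + z)) \o shift y)
             (t *: basis_vec R k) - f (h *: ej + y)))
         = (fun t : R => t^-1 *: ((f \o shift (h *: ej + y))
             (t *: basis_vec R k) - f (h *: ej + y))).
    by apply/funext => t /=; rewrite addrCA.
  by rewrite /derivable /partial /derive E; split=> //; exact: smooth_derivable.
have dg y : derivable g y ei.
  by apply: derivableB; [exact: (shift_der i y).1|exact: smooth_derivable].
have [s sh Es] := mvt_line x h0 dg.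
have [|t th Et] := mvt_line (f := partial i f) (s *: ei + x) h0 (j := j).
  by move=> y; apply/smooth_derivable/smooth_partial.
exists (s, t); split=> //=.
have -> : second_diff f i j h x = g (h *: ei + x) - g x.
  by rewrite /second_diff /g addrCA; ring.
rewrite Es {1}/partial deriveB; last 2 first.
- exact: (shift_der i _).1.
- exact: smooth_derivable.
by rewrite (shift_der i _).2 expr2 mulrA -Et.
Qed.

End Smooth.

(** * Symmetry of second derivatives and second derivatives at a maximum *)

Section Schwarz.
Variable R : realType.
Implicit Types (f g : scalar_field R) (i j k : 'I_3) (x y : 'rV[R]_3).

Lemma continuous_corner g i j x (e : R) : continuous g -> 0 < e ->
  exists2 d : R, 0 < d & forall s t : R, `|s| < d -> `|t| < d ->
    `|g (t *: basis_vec R j + (s *: basis_vec R i + x)) - g x| < e.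
Proof.
move=> cg e0; have /cvgrPdist_lt/(_ e e0) := cg x.
move=> /nbhs_normP[r /= r0 rP].
set C := `|basis_vec R i| + `|basis_vec R j| + 1.
have C0 : 0 < C by rewrite ltr_wpDl ?addr_ge0.
exists (r / C); first exact: divr_gt0.
move=> s t sd td; rewrite distrC; apply: rP; rewrite /ball_ /= distrC addrA addrK.
apply: (le_lt_trans (ler_normD _ _)); rewrite !normrZ.
have : `|t| * `|basis_vec R j| + `|s| * `|basis_vec R i|
  <= r / C * `|basis_vec R j| + r / C * `|basis_vec R i|.
  by apply: lerD; apply: ler_wpM2r => //; exact: ltW.
move=> /le_lt_trans; apply; rewrite -mulrDr mulrAC ltr_pdivrMr // ltr_pM2l //.
by rewrite /C addrC ltrDl.
Qed.

Lemma second_diffC f i j (h : R) x : second_diff f i j h x = second_diff f j i h x.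
Proof. by rewrite /second_diff addrCA; ring. Qed.

(** Schwarz: the second difference is symmetric in i and j, so the two mixed
    derivatives take a common value at points arbitrarily close to x. *)
Lemma partialC f i j : smooth f -> partial i (partial j f) = partial j (partial i f).
Proof.
move=> sf; apply/funext => x; apply/eqP; rewrite -subr_eq0 -normr_le0.
apply/ler_addgt0Pl => e e0; rewrite addr0.
have e2 : 0 < e / 2 by rewrite divr_gt0.
have [d d0 dP] := continuous_corner i j x
  (smooth_continuous (smooth_partial j (smooth_partial i sf))) e2.
have [d' d'0 d'P] := continuous_corner j i x
  (smooth_continuous (smooth_partial i (smooth_partial j sf))) e2.
pose h := Num.min d d'.
have h0 : 0 < h by rewrite lt_min d0.
have small s : 0 < s < h -> `|s| < d /\ `|s| < d'.
  by move=> /andP[s0]; rewrite lt_min gtr0_norm // => /andP[].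
have [[s t] [/= /small[sd _] /small[td _] E]] := second_diffP i j x sf h0.
have [[s' t'] [/= /small[_ sd'] /small[_ td'] E']] := second_diffP j i x sf h0.
have h2 : h ^+ 2 != 0 by rewrite expf_neq0 // gt_eqF.
have {h2}E2 := mulIf h2 (etrans (esym E') (etrans (second_diffC f j i h x) E)).
have := dP _ _ sd td; have := d'P _ _ sd' td'; rewrite E2.
set a := partial j _ _; set b := partial i _ x; set c := partial j _ x.
move=> h1 h2; have -> : b - c = - (a - b) + (a - c) by ring.
rewrite [leRHS]splitr; apply: (le_trans (ler_normD _ _)).
by rewrite normrN; exact: lerD (ltW h1) (ltW h2).
Qed.

(** The second difference centred at x, f (x + h e_j) - 2 f x + f (x - h e_j),
    is nonpositive at a maximum, and it is h^2 times a second derivative taken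
    near x. *)
Lemma partial2_max_le0 f j x : smooth f -> (forall y, f y <= f x) ->
  partial j (partial j f) x <= 0.
Proof.
move=> sf fmax; rewrite leNgt; apply/negP => D0.
have [d d0 dP] := continuous_corner j j x
  (smooth_continuous (smooth_partial j (smooth_partial j sf))) D0.
have h0 : 0 < d / 2 by rewrite divr_gt0.
set h := d / 2 in h0; have hd : h < d by rewrite /h ltr_pdivrMr// ltr_pMr// ltr1n.
have [[s t] [/= /andP[s0 sh] /andP[t0 th] E]] :=
  second_diffP j j (- h *: basis_vec R j + x) sf h0.
have sd : `|s - h| < d by rewrite ltr_norml; apply/andP; split; lra.
have td : `|t| < d by rewrite gtr0_norm//; exact: lt_trans th hd.
have := dP _ _ sd td; rewrite ltr_norml => /andP[/[swap] _].
have -> : t *: basis_vec R j + ((s - h) *: basis_vec R j + x)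
  = t *: basis_vec R j + (s *: basis_vec R j + (- h *: basis_vec R j + x)).
  by rewrite scalerBl scaleNr !addrA.
set a := partial j _ _ in E *; move=> a0.
have {}a0 : 0 < a by move: a0; lra.
have : 0 < second_diff f j j h (- h *: basis_vec R j + x).
  by rewrite E mulr_gt0// exprn_gt0.
rewrite /second_diff scaleNr (addrA _ (- _) x) subrr add0r.
have := fmax (h *: basis_vec R j + x); have := fmax (- (h *: basis_vec R j) + x); lra.
Qed.

Lemma partial_laplacian f j : smooth f ->
  partial j (laplacian f) = laplacian (partial j f).
Proof.
move=> sf; rewrite /laplacian partial_sum; last first.
  by move=> l; do 2 apply: smooth_partial.
apply/funext => x; apply: eq_bigr => l _.
by rewrite (partialC l j sf) (partialC l j (smooth_partial l sf)).
Qed.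

Lemma laplacianD f g : smooth f -> smooth g ->
  laplacian (f \+ g) = laplacian f \+ laplacian g.
Proof.
move=> sf sg; apply/funext => x; rewrite /laplacian /= -big_split.
by apply: eq_bigr => j _ /=; rewrite !partialD //;
  move=> y; apply: smooth_derivable => //; exact: smooth_partial.
Qed.

Lemma laplacianZ c f : smooth f -> laplacian (c \*: f) = c \*: laplacian f.
Proof.
move=> sf; apply/funext => x; rewrite /laplacian /= scaler_sumr.
by apply: eq_bigr => j _ /=; rewrite !partialZ //;
  move=> y; apply: smooth_derivable => //; exact: smooth_partial.
Qed.

Lemma laplacian_sum (I : Type) (r : seq I) (F : I -> scalar_field R) :
  (forall l, smooth (F l)) ->
  laplacian (fun x => \sum_(l <- r) F l x) = fun x => \sum_(l <- r) laplacian (F l) x.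
Proof.
move=> sF; apply/funext => x; rewrite /laplacian exchange_big.
by apply: eq_bigr => j _; rewrite !partial_sum // => l; exact: smooth_partial.
Qed.

Lemma laplacian_sqr f x : smooth f ->
  laplacian (f \* f) x = 2 * (f x * laplacian f x + \sum_(j < 3) partial j f x ^+ 2).
Proof.
move=> sf; rewrite /laplacian mulr_sumr -big_split mulr_sumr /=.
apply: eq_bigr => j _.
have df y k : derivable f y (basis_vec R k) by exact: smooth_derivable.
have dpf y k : derivable (partial j f) y (basis_vec R k).
  exact/smooth_derivable/smooth_partial.
rewrite partialM // partialD ?partialM //=.
- by ring.
- by move=> y; exact: derivableM.
- by move=> y; exact: derivableM.
Qed.

End Schwarz.

(** * Periodic harmonic functions are constant *)

Section Liouville.
Variable R : realType.
Implicit Types (f g : scalar_field R) (i j k : 'I_3) (x y : 'rV[R]_3).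

Lemma periodic_int (T : Type) (f : 'rV[R]_3 -> T) j (m : int) x :
  periodic2pi f -> f ((2 * pi * m%:~R) *: basis_vec R j + x) = f x.
Proof.
move=> pf; have P n y : f ((2 * pi * n%:R) *: basis_vec R j + y) = f y.
  elim: n y => [|n IH] y; first by rewrite mulr0 scale0r add0r.
  by rewrite (mulrSr 1 n) mulrDr mulr1 scalerDl -addrA IH addrC pf.
case: m => n; first exact: P.
have <- := P n.+1 ((2 * pi * (Negz n)%:~R) *: basis_vec R j + x).
by rewrite NegzE mulrNz mulrN scaleNr addrA subrr add0r.
Qed.

Lemma periodic_partial f j : periodic2pi f -> periodic2pi (partial j f).
Proof.
move=> pf x k; rewrite /partial /derive.
set p := _ *: basis_vec R k.
suff -> : (fun h : R => h^-1 *: ((f \o shift (x + p)) (h *: basis_vec R j) - f (x + p)))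
  = (fun h : R => h^-1 *: ((f \o shift x) (h *: basis_vec R j) - f x)) by [].
by apply/funext => h /=; rewrite addrA !pf.
Qed.

(** Every point is congruent modulo the periods to a point of the compact cube
    [0, 2 pi]^3. *)
Lemma periodic_max f : continuous f -> periodic2pi f ->
  exists c, forall x, f x <= f c.
Proof.
move=> cf pf.
pose A := [set v : 'rV[R]_3 | forall i, `[0, 2 * pi]%classic (v ord0 i)].
have tpi : 0 < 2 * pi :> R by rewrite mulr_gt0 // pi_gt0.
have [|||c _ cmax] := @EVT_max_rV R 3 f A.
- by exists 0 => i; rewrite mxE /= in_itv /= lexx ltW.
- by apply: (@rV_compact R 3 (fun=> `[0, 2 * pi]%classic)) => _; exact: segment_compact.
- exact: continuous_subspaceT.
exists c => x.
pose m j : int := - Num.floor (x ord0 j / (2 * pi)).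
have shift (r : seq 'I_3) :
    f (\sum_(j <- r) (2 * pi * (m j)%:~R) *: basis_vec R j + x) = f x.
  elim: r => [|j r IH]; first by rewrite big_nil add0r.
  by rewrite big_cons -addrA periodic_int.
rewrite -(shift (index_enum 'I_3)); apply: cmax; apply/mem_set => i /=.
rewrite mxE summxE (bigD1 i) //= big1 ?addr0; last first.
  by move=> j /negPf ji; rewrite !mxE eq_sym ji andbF mulr0.
rewrite !mxE !eqxx mulr1 /m in_itv /=.
set t := x ord0 i; have /andP[] := floor_itv (t / (2 * pi)).
rewrite ler_pdivlMr // ltr_pdivrMr // intrD mulrNz; set F := _%:~R.
by move=> h1 h2; apply/andP; split; nra.
Qed.

(** Bernstein's argument.  For e > 0 put F = |grad f|^2 + e f^2.  If f is
    harmonic then lap F >= 2 e |grad f|^2, while lap F <= 0 at a maximum c of F,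
    so grad f c = 0.  Hence |grad f|^2 <= F <= F c = e (f c)^2 everywhere, and
    e is arbitrary. *)
Lemma periodic_harmonic_cst f j : smooth f -> periodic2pi f ->
  (forall x, laplacian f x = 0) -> partial j f = cst 0.
Proof.
move=> sf pf harm.
have lap0 : laplacian f = cst 0 by apply/funext.
have [M Mmax] : exists M, forall y, f y ^+ 2 <= M.
  have [||c cP] := @periodic_max (f \* f).
  - exact/smooth_continuous/smoothM.
  - by move=> x k /=; rewrite !pf.
  by exists (f c * f c) => y; rewrite expr2; exact: cP.
pose G := fun x => \sum_(k < 3) (partial k f \* partial k f) x.
have sp k : smooth (partial k f) by exact: smooth_partial.
have sG : smooth G by apply: smooth_sum => k; exact: smoothM.
have sff : smooth (f \* f) by exact: smoothM.
(* the maximum principle for F *)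
have bound (e : R) : 0 < e -> forall x, G x <= e * M.
  move=> e0; have sF : smooth (G \+ e \*: (f \* f)).
    by apply: smoothD => //; exact: smoothZ.
  have [||c cmax] := @periodic_max (G \+ e \*: (f \* f)).
  - exact: smooth_continuous.
  - move=> x k; rewrite /= !pf; congr (_ + _); apply: eq_bigr => l _ /=.
    by rewrite !(periodic_partial l pf).
  have lapF : laplacian (G \+ e \*: (f \* f)) c <= 0.
    by apply: sumr_le0 => k _; exact: partial2_max_le0.
  have Gc0 : G c = 0.
    move: lapF; rewrite laplacianD //; last exact: smoothZ.
    rewrite laplacianZ //= laplacian_sqr // lap0 /= mulr0 add0r.
    have -> : \sum_(k < 3) partial k f c ^+ 2 = G c.
      by apply: eq_bigr => k _; rewrite expr2.
    have Gc : 0 <= G c by apply: sumr_ge0 => k _; rewrite /= -expr2 sqr_ge0.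
    have : 0 <= laplacian G c.
      rewrite /G laplacian_sum; last by move=> l; exact: smoothM.
      apply: sumr_ge0 => k _; rewrite (laplacian_sqr c (sp k)) -(partial_laplacian k sf).
      rewrite lap0 partial_cst /= mulr0 add0r mulr_ge0 //.
      by apply: sumr_ge0 => l _; exact: sqr_ge0.
    rewrite /GRing.scale /= => h1 h2; apply/eqP; rewrite eq_le Gc andbT.
    rewrite -(pmulr_rle0 _ e0); lra.
  move=> x; apply: (@le_trans _ _ ((G \+ e \*: (f \* f)) x)).
    rewrite /= lerDl; apply: mulr_ge0; first exact: ltW.
    by rewrite -expr2 sqr_ge0.
  apply: (le_trans (cmax x)); rewrite /= Gc0 add0r.
  by apply: ler_wpM2l; [exact: ltW | rewrite -expr2].
have M0 : 0 <= M by apply: le_trans (Mmax 0); exact: sqr_ge0.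
apply/funext => x; apply/eqP; rewrite -sqrf_eq0 eq_le sqr_ge0 andbT.
apply/ler_addgt0Pl => e e0; rewrite addr0.
(* the choice e / (M + 1), in place of e / M, also covers M = 0 *)
have Me : 0 < M + 1 by lra.
have := bound _ (divr_gt0 e0 Me) x; rewrite -mulrA (mulrC _ M) mulrA => h.
have : e * M / (M + 1) <= e by rewrite ler_pdivrMr // ler_pM2l // lerDl.
apply: le_trans; apply: le_trans h.
rewrite /G (bigD1 j) //= -expr2 lerDl.
by apply: sumr_ge0 => k _; rewrite -expr2 sqr_ge0.
Qed.

End Liouville.

(** * Constant coefficient differential operators *)

Section Polynomials.
Import -(notations) mpoly.
Variable R : realType.
Implicit Types (p q : mpoly.mpoly 3 R) (m : mpoly.multinom 3).
Implicit Types (f g : scalar_field R) (x : 'rV[R]_3).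

(** The exponent of t in the monomial m after the substitution x_k = t^(N^k):
    the number whose base N digits are the exponents of m, if these are less
    than N. *)
Definition kronecker_exp (N : nat) m : nat := (m 0%R + N * (m 1%R + N * m 2%R))%N.

Lemma ord3_cases (P : 'I_3 -> Prop) : P 0 -> P 1 -> P 2 -> forall j, P j.
Proof.
move=> P0 P1 P2 [[|[|[|//]]] lj].
- by rewrite (_ : Ordinal lj = 0) //; apply/val_inj.
- by rewrite (_ : Ordinal lj = 1) //; apply/val_inj.
- by rewrite (_ : Ordinal lj = 2) //; apply/val_inj.
Qed.

Lemma kronecker_exp_inj (N : nat) m m' :
  (forall i, (m i < N)%N) -> (forall i, (m' i < N)%N) ->
  kronecker_exp N m = kronecker_exp N m' -> m = m'.
Proof.
move=> lm lm'; rewrite /kronecker_exp => E.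
have N0 : (0 < N)%N by exact: leq_ltn_trans (lm 0).
have digit a a' b b' : (a < N)%N -> (a' < N)%N ->
    (a + N * b = a' + N * b')%N -> a = a' /\ b = b'.
  move=> la la' e; have ea : a = a'.
    move/(congr1 (modn^~ N)): e.
    by rewrite ![(N * _)%N]mulnC ![(_ + _ * N)%N]addnC !modnMDl !modn_small.
  split=> //; move: e; rewrite ea => /addnI /eqP.
  by rewrite eqn_pmul2l // => /eqP.
have [E0 /(digit _ _ _ _ (lm 1) (lm' 1))[E1 E2]] :=
  digit _ _ _ _ (lm 0) (lm' 0) E.
by apply/mnmP; apply: ord3_cases.
Qed.

Lemma poly_eq0_of_horner (q : {poly R}) : (forall t, q.[t] = 0) -> q = 0.
Proof.
move=> q0; apply: (@roots_geq_poly_eq0 _ q [seq i%:R | i <- iota 0 (size q)]).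
- by apply/allP => t _; rewrite rootE q0.
- by rewrite map_inj_uniq ?iota_uniq // => a b /eqP; rewrite eqr_nat => /eqP.
- by rewrite size_map size_iota.
Qed.

(** Kronecker substitution: for N larger than all exponents, x_k = t^(N^k) maps
    distinct monomials to distinct powers of t.  The resulting polynomial in t
    vanishes everywhere, so all its coefficients, which are those of p, are
    zero. *)
Lemma mpoly_eq0_of_meval p :
  (forall x : 'I_3 -> R, meval x p = 0) -> p = 0.
Proof.
move=> p0; apply/mpolyP => m0; rewrite mcoeff0.
have [m0p|/memN_msupp_eq0//] := boolP (m0 \in msupp p).
pose N := msize p.
have ltN m i : m \in msupp p -> (m i < N)%N.
  move=> /msize_mdeg_lt; apply: leq_ltn_trans; rewrite mdegE.
  by rewrite (bigD1 i) //= leq_addr.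
pose q : {poly R} := \sum_(m <- msupp p) mcoeff m p *: 'X^(kronecker_exp N m).
have q0 : q = 0.
  apply: poly_eq0_of_horner => t.
  rewrite -(p0 (fun i : 'I_3 => t ^+ (N ^ i)%N)) mevalE horner_sum.
  apply: eq_bigr => m _; rewrite hornerZ hornerXn; congr (_ * _).
  rewrite !big_ord_recl big_ord0 /kronecker_exp /= mulr1 -!exprM -!exprD.
  congr (_ ^+ _).
  have -> : lift ord0 (lift ord0 ord0) = 2 :> 'I_3 by apply/val_inj.
  have -> : lift ord0 ord0 = 1 :> 'I_3 by apply/val_inj.
  by rewrite /bump /= expn0 expn1 mul1n mulnDr mulnA mulnn.
have : q`_(kronecker_exp N m0) = 0 by rewrite q0 coef0.
rewrite coef_sum (bigD1_seq m0) ?msupp_uniq //= coefZ coefXn eqxx mulr1.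
rewrite big_seq_cond big1 ?addr0 // => m /andP[mp mm0].
rewrite coefZ coefXn; case: eqP => [E|]; last by rewrite mulr0.
by case/eqP: mm0; apply: (@kronecker_exp_inj N) => // i; exact: ltN.
Qed.

Definition mono_op m f : scalar_field R :=
  iter (m 0) (partial 0) (iter (m 1) (partial 1) (iter (m 2) (partial 2) f)).

Lemma smooth_iter n j f : smooth f -> smooth (iter n (partial j) f).
Proof. by move=> sf; elim: n => [//|n IH]; exact: (smooth_partial j IH). Qed.

Lemma smooth_mono_op m f : smooth f -> smooth (mono_op m f).
Proof. by move=> sf; exact: (smooth_iter _ _ (smooth_iter _ _ (smooth_iter _ _ sf))). Qed.

Lemma partial_iter n i j f : smooth f ->
  partial i (iter n (partial j) f) = iter n (partial j) (partial i f).
Proof.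
move=> sf; elim: n => [//|n /= <-].
exact: (partialC i j (smooth_iter n j sf)).
Qed.

Lemma partial_mono_op m j f : smooth f ->
  partial j (mono_op m f) = mono_op m (partial j f).
Proof.
move=> sf; have s2 := smooth_iter (m 2) 2 sf; have s1 := smooth_iter (m 1) 1 s2.
by rewrite /mono_op (partial_iter _ _ _ s1) (partial_iter _ _ _ s2) partial_iter.
Qed.

Lemma mono_opU j m f : smooth f ->
  mono_op (mnm_add (mnm1 j) m) f = partial j (mono_op m f).
Proof.
move=> sf; have s2 := smooth_iter (m 2) 2 sf; have s1 := smooth_iter (m 1) 1 s2.
rewrite /mono_op !mnmDE !mnm1E; elim/ord3_cases: j => /=.
- by [].
- by rewrite (partial_iter (m 0) 1 0 s1).
- by rewrite (partial_iter (m 0) 2 0 s1) (partial_iter (m 1) 2 1 s2).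
Qed.

Lemma poly_opE p f : poly_op p f = fun x => \sum_(m <- msupp p) mcoeff m p * mono_op m f x.
Proof. by []. Qed.

(** The index set no longer depends on the support of p, which makes
    additivity in p a termwise statement. *)
Lemma poly_opwE (k : nat) p f x : (msize p <= k)%N ->
  poly_op p f x = \sum_(m : bmultinom 3 k) mcoeff m p * mono_op m f x.
Proof.
move=> lpk; rewrite poly_opE (ssrcomplements.big_mksub (bmultinom 3 k)) /=; first last.
- by move=> m /msize_mdeg_lt /leq_trans; apply.
- exact: msupp_uniq.
by rewrite big_rmcond //= => m /memN_msupp_eq0 ->; rewrite mul0r.
Qed.

Lemma poly_opD p q f : poly_op (p + q) f = poly_op p f \+ poly_op q f.
Proof.
apply/funext => x /=; pose k := maxn (msize (p + q)) (maxn (msize p) (msize q)).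
rewrite !(@poly_opwE k) ?leq_max ?leqnn ?orbT // -big_split /=.
by apply: eq_bigr => m _; rewrite mcoeffD mulrDl.
Qed.

Lemma poly_op0 f : poly_op 0 f = cst 0.
Proof. by apply/funext => x; rewrite poly_opE msupp0 big_nil. Qed.

Lemma poly_opZX c m f x : poly_op (c *: mpolyX R m) f x = c * mono_op m f x.
Proof.
have [->|c0] := eqVneq c 0; first by rewrite scale0r poly_op0 mul0r.
by rewrite poly_opE msuppMCX // big_seq1 mcoeffZ mcoeffX eqxx mulr1.
Qed.

Lemma smooth_poly_op p f : smooth f -> smooth (poly_op p f).
Proof.
move=> sf; rewrite poly_opE; apply: smooth_sum => m.
by apply: smoothZ; exact: smooth_mono_op.
Qed.

Lemma poly_op_partial p j f : smooth f ->
  poly_op p (partial j f) = partial j (poly_op p f).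
Proof.
move=> sf; rewrite !poly_opE partial_sum; last first.
  by move=> m; apply: smoothZ; exact: smooth_mono_op.
apply/funext => x; apply: eq_bigr => m _.
rewrite -partial_mono_op // [in RHS](@partialZ _ _ (mono_op m f)) // => y.
by apply/smooth_derivable/smooth_mono_op.
Qed.

Lemma poly_opXM j p f : smooth f ->
  poly_op (mpolyX R (mnm1 j) * p) f = partial j (poly_op p f).
Proof.
move=> sf; elim/mpolyind: p => [|c m p _ _ IH].
  by rewrite mulr0 poly_op0 partial_cst.
rewrite mulrDr !poly_opD IH partialD; last 2 first.
- by move=> y; apply/smooth_derivable/smooth_poly_op.
- by move=> y; apply/smooth_derivable/smooth_poly_op.
congr (_ \+ _); apply/funext => x.
rewrite -scalerAr -mpolyXD poly_opZX mono_opU //.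
have -> : poly_op (c *: mpolyX R m) f = c \*: mono_op m f.
  by apply/funext => y; rewrite poly_opZX.
by rewrite partialZ // => y; apply/smooth_derivable/smooth_mono_op.
Qed.

Lemma mono_opZ m c f : smooth f -> mono_op m (c \*: f) = c \*: mono_op m f.
Proof.
move=> sf; have itZ n j g : smooth g ->
    iter n (partial j) (c \*: g) = c \*: iter n (partial j) g.
  move=> sg; elim: n => //= n ->; rewrite partialZ // => y.
  exact/smooth_derivable/smooth_iter.
have s2 := smooth_iter (m 2) 2 sf; have s1 := smooth_iter (m 1) 1 s2.
by rewrite /mono_op (itZ _ _ _ sf) (itZ _ _ _ s2) (itZ _ _ _ s1).
Qed.

Lemma poly_opZ p c f : smooth f ->
  poly_op p (c \*: f) = c \*: poly_op p f.
Proof.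
move=> sf; apply/funext => x; rewrite !poly_opE /= scaler_sumr.
apply: eq_bigr => m _; rewrite (mono_opZ m c sf) /= /GRing.scale /=.
exact: mulrCA.
Qed.

Lemma poly_op_cst0 p : poly_op p (cst 0) = cst 0.
Proof.
have := poly_opZ p 0 (@smooth_cst R 0).
have -> : 0 \*: cst 0 = cst 0 :> scalar_field R.
  by apply/funext => x /=; rewrite scale0r.
by move=> ->; apply/funext => x /=; rewrite scale0r.
Qed.

Lemma periodic_poly_op p f : periodic2pi f -> periodic2pi (poly_op p f).
Proof.
move=> pf; have perI n j g : periodic2pi g -> periodic2pi (iter n (partial j) g).
  by move=> pg; elim: n => //= n; exact: periodic_partial.
move=> x k; rewrite !poly_opE; apply: eq_bigr => m _; congr (_ * _).
exact: (perI _ _ _ (perI _ _ _ (perI _ _ _ pf))).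
Qed.

Lemma laplacian_poly_op p f : smooth f ->
  laplacian (poly_op p f) = poly_op p (laplacian f).
Proof.
move=> sf; have lapI n j g : smooth g ->
    laplacian (iter n (partial j) g) = iter n (partial j) (laplacian g).
  move=> sg; elim: n => [//|n /= <-].
  exact/esym/(partial_laplacian j (smooth_iter n j sg)).
rewrite !poly_opE laplacian_sum; last first.
  by move=> m; apply: smoothZ; exact: smooth_mono_op.
apply/funext => x; apply: eq_bigr => m _.
rewrite (laplacianZ (mcoeff m p) (smooth_mono_op m sf)) /=.
have s2 := smooth_iter (m 2) 2 sf; have s1 := smooth_iter (m 1) 1 s2.
by rewrite /mono_op (lapI _ _ _ s1) (lapI _ _ _ s2) (lapI _ _ _ sf).
Qed.

Lemma admissible_mpoly (a : 'I_3 -> mpoly.mpoly 3 R) : admissible a ->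
  \sum_(j < 3) mpolyX R (mnm1 j) * a j = 0.
Proof.
move=> adm; apply: mpoly_eq0_of_meval => x; rewrite raddf_sum; apply: etrans (adm x).
by apply: eq_bigr => j _; rewrite /= mevalM mevalXU.
Qed.

Lemma admissible_div_free (a : 'I_3 -> mpoly.mpoly 3 R) f x :
  admissible a -> smooth f -> \sum_(j < 3) partial j (poly_op (a j) f) x = 0.
Proof.
move=> /admissible_mpoly adm sf.
transitivity (poly_op (\sum_(j < 3) mpolyX R (mnm1 j) * a j) f x); last first.
  by rewrite adm poly_op0.
elim/big_rec2: _ => [|j u v _ ->]; first by rewrite poly_op0.
by rewrite poly_opD /= (poly_opXM j (a j) sf).
Qed.

End Polynomials.

(** * Fields with curl u = - l u *)

Section Beltrami.
Variable R : realType.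
Implicit Types (f g psi : scalar_field R) (j k : 'I_3) (x y : 'rV[R]_3).
Implicit Types (a : 'I_3 -> mpoly.mpoly 3 R) (l c : R).

Lemma ord3_shift j : [/\ j + 1 + 1 = j + 2, j + 1 + 2 = j, j + 2 + 1 = j
  & j + 2 + 2 = j + 1].
Proof. by elim/ord3_cases: j; split; apply/val_inj. Qed.

Lemma sum_ord3 (F : 'I_3 -> R) j : \sum_k F k = F j + F (j + 1) + F (j + 2).
Proof.
have E : \sum_k F k = F 0 + F 1 + F 2.
  rewrite !big_ord_recl big_ord0 addr0 addrA.
  by congr (F _ + F _ + F _); apply/val_inj.
have [] : [/\ 1 + 1 = 2 :> 'I_3, 1 + 2 = 0 :> 'I_3, 2 + 1 = 0 :> 'I_3
  & 2 + 2 = 1 :> 'I_3] by split; apply/val_inj.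
by rewrite E; elim/ord3_cases: j => e11 e12 e21 e22;
  rewrite ?add0r ?e11 ?e12 ?e21 ?e22; ring.
Qed.

(** (u . nabla) u = grad (|u|^2 / 2) - u x curl u, and the cross product
    vanishes when the curl is parallel to u. *)
Lemma curl_eigen_static_euler (u : vector_field R) l :
  smooth_field u ->
  (forall x j, partial (j + 1) (component u (j + 2)) x
     - partial (j + 2) (component u (j + 1)) x = - l * component u j x) ->
  (forall x, divergence u x = 0) ->
  static_euler u (fun x => \sum_(k < 3) - 2^-1 * (component u k x * component u k x)).
Proof.
move=> su curl divu; split=> // [|x j].
  by apply: smooth_sum => k; apply: smoothZ; apply: smoothM; exact: su.
have duu k y i : derivable (component u k \* component u k) y (basis_vec R i).
  exact/smooth_derivable/smoothM.
have -> : partial j (fun x => \sum_(k < 3) - 2^-1 *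
    (component u k x * component u k x)) x
  = \sum_(k < 3) - (component u k x * partial j (component u k) x).
  rewrite (@partial_sum _ _ _
    (fun k => - 2^-1 \*: (component u k \* component u k))); last first.
    by move=> k; apply: smoothZ; exact: smoothM.
  apply: eq_bigr => k _; rewrite partialZ // partialM; last 2 first.
  - by move=> y; exact: smooth_derivable.
  - by move=> y; exact: smooth_derivable.
  by rewrite /= /GRing.scale /=; field.
rewrite /advection -big_split (sum_ord3 _ j) /=.
have [e11 e12 e21 e22] := ord3_shift j.
have := curl x (j + 1); have := curl x (j + 2); rewrite e11 e12 e21 e22.
rewrite /component; set p := partial (j + 1) _ x; set q := partial j _ x.
set r := partial j _ x; set s := partial (j + 2) _ x.
set u1 := u x ord0 (j + 1); set u2 := u x ord0 (j + 2).
move=> E2 E1; have -> : p = q + l * u2 by move: E2; rewrite mulNr => ?; lra.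
have -> : s = r - l * u1 by move: E1; rewrite mulNr => ?; lra.
ring.
Qed.

Definition curl (v : 'I_3 -> scalar_field R) j : scalar_field R :=
  partial (j + 1) (v (j + 2)) \+ -1 \*: partial (j + 2) (v (j + 1)).

(** The construction W = l v - curl v, from a divergence-free v with
    lap v = - l^2 v. *)
Section Potential.
Variables (v : 'I_3 -> scalar_field R) (l : R).
Hypotheses (sv : forall j, smooth (v j))
  (divv : forall x, \sum_(j < 3) partial j (v j) x = 0)
  (lapv : forall j, laplacian (v j) = - l ^+ 2 \*: v j).

Definition beltrami j : scalar_field R := l \*: v j \+ -1 \*: curl v j.

Lemma smooth_curl j : smooth (curl v j).
Proof. by apply: smoothD; [|apply: smoothZ]; exact: smooth_partial. Qed.

Lemma smooth_beltrami j : smooth (beltrami j).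
Proof. by apply: smoothD; apply: smoothZ => //; exact: smooth_curl. Qed.

Lemma partial_curl k j : partial k (curl v j)
  = partial k (partial (j + 1) (v (j + 2)))
    \+ -1 \*: partial k (partial (j + 2) (v (j + 1))).
Proof.
have d i m n y : derivable (partial i (v m)) y (basis_vec R n).
  exact/smooth_derivable/smooth_partial.
rewrite /curl partialD ?partialZ // => y.
exact: derivableZ.
Qed.

Lemma partial_beltrami k j :
  partial k (beltrami j) = l \*: partial k (v j) \+ -1 \*: partial k (curl v j).
Proof.
have dv m n y : derivable (v m) y (basis_vec R n) by exact: smooth_derivable.
have dc m n y : derivable (curl v m) y (basis_vec R n).
  exact/smooth_derivable/smooth_curl.
by rewrite /beltrami partialD ?partialZ // => y; exact: derivableZ.
Qed.

Lemma div_curl x : \sum_(j < 3) partial j (curl v j) x = 0.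
Proof.
under eq_bigr do rewrite partial_curl.
have [] := ord3_shift 0; rewrite (sum_ord3 _ 0) !add0r /= => -> -> -> ->.
rewrite (partialC 1 0 (sv 2)) (partialC 2 0 (sv 1)) (partialC 2 1 (sv 0)).
rewrite /GRing.scale /=.
(* the atoms are generalized so that ring compares variables only *)
by do 3 move: (partial _ (partial _ _) x) => ?; ring.
Qed.

Lemma div_beltrami x : \sum_(j < 3) partial j (beltrami j) x = 0.
Proof.
under eq_bigr do rewrite partial_beltrami /=.
by rewrite big_split -!scaler_sumr divv div_curl /GRing.scale /= !mulr0 addr0.
Qed.

(** curl curl v = grad div v - lap v. *)
Lemma curl_curl j x :
  partial (j + 1) (curl v (j + 2)) x - partial (j + 2) (curl v (j + 1)) x
  = l ^+ 2 * v j x.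
Proof.
have [e11 e12 e21 e22] := ord3_shift j.
rewrite !partial_curl e11 e12 e21 e22 /=.
rewrite (partialC (j + 1) j (sv _)) (partialC (j + 2) j (sv _)).
have divE : \sum_k partial j (partial k (v k)) x = 0.
  transitivity (partial j (fun x => \sum_(k < 3) partial k (v k) x) x).
    by rewrite partial_sum => [//|k]; exact: (smooth_partial k (sv k)).
  by rewrite (_ : (fun x => _) = cst 0) ?partial_cst //; apply/funext.
have lapE : \sum_k partial k (partial k (v j)) x = - l ^+ 2 * v j x.
  by have := congr1 (@^~ x) (lapv j); rewrite /laplacian /= => ->.
move: divE; rewrite (sum_ord3 _ j).
move: lapE; rewrite (sum_ord3 _ j).
rewrite /GRing.scale /=.
(* the atoms are generalized so that lra compares variables only *)
by do 5 move: (partial _ (partial _ _) x) => ?; move: (v j x) => ?; lra.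
Qed.

Lemma curl_beltrami j x :
  partial (j + 1) (beltrami (j + 2)) x - partial (j + 2) (beltrami (j + 1)) x
  = - l * beltrami j x.
Proof.
have := curl_curl j x; rewrite !partial_beltrami /= /GRing.scale /=.
rewrite /beltrami /= /GRing.scale /=.
move: (partial _ (curl v (j + 1)) x) => B.
move: (partial _ (curl v (j + 2)) x) => A /(canRL (subrK _)) ->.
rewrite /curl /= /GRing.scale /=.
by do 2 move: (partial _ _ x) => ?; ring.
Qed.

Lemma laplacian_beltrami j : laplacian (beltrami j) = - l ^+ 2 \*: beltrami j.
Proof.
have sp i m : smooth (partial i (v m)) by exact: smooth_partial.
rewrite /beltrami laplacianD; last 2 first.
- exact: smoothZ.
- exact/smoothZ/smooth_curl.
rewrite (laplacianZ _ (sv j)) (laplacianZ _ (smooth_curl j)) lapv {1}/curl.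
rewrite laplacianD //; last exact: smoothZ.
rewrite (laplacianZ _ (sp _ _)) -!partial_laplacian // !lapv.
have dv m n y : derivable (v m) y (basis_vec R n) by exact: smooth_derivable.
rewrite !partialZ //; apply/funext => x; rewrite /curl /= /GRing.scale /=; ring.
Qed.

End Potential.

Definition beltrami_field a l psi : vector_field R :=
  fun x => l *: vec_op a psi x + cross_op a psi x.

(** {A(nabla) x nabla} psi = - curl (A(nabla) psi). *)
Lemma component_beltrami a l psi j : smooth psi ->
  component (beltrami_field a l psi) j = beltrami (fun k => poly_op (a k) psi) l j.
Proof.
move=> sf; apply/funext => x; rewrite /component /beltrami_field /beltrami /curl.
rewrite !mxE !poly_op_partial // /= /GRing.scale /=; ring.
Qed.

Lemma laplace_eigenspaceZ c l psi :
  laplace_eigenspace l psi -> laplace_eigenspace l (c \*: psi).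
Proof.
move=> [sf pf ef]; split; first exact: smoothZ.
  by move=> x k; rewrite /= pf.
by move=> x; rewrite laplacianZ //= -scalerN ef /GRing.scale /= mulrCA.
Qed.

Lemma beltrami_fieldZ a l c psi : smooth psi ->
  beltrami_field a l (c \*: psi) = fun x => c *: beltrami_field a l psi x.
Proof.
move=> sf; apply/funext => x; apply/rowP => j; rewrite !mxE.
have dZ k : partial k (c \*: psi) = c \*: partial k psi.
  by apply: partialZ => y; exact: smooth_derivable.
rewrite !dZ (poly_opZ (a j) c sf).
rewrite (poly_opZ (a (j + 1)) c (smooth_partial (j + 2) sf)).
rewrite (poly_opZ (a (j + 2)) c (smooth_partial (j + 1) sf)).
rewrite /= /GRing.scale /=; do 3 move: (poly_op _ _ x) => ?; ring.
Qed.

Lemma periodic_beltrami a l psi : smooth psi -> periodic2pi psi ->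
  periodic2pi (beltrami_field a l psi).
Proof.
move=> sf pf x k; apply/rowP => j; rewrite !mxE.
by rewrite !(periodic_poly_op _ pf) !(periodic_poly_op _ (periodic_partial _ pf)).
Qed.

Section Eigen.
Variables (a : 'I_3 -> mpoly.mpoly 3 R) (l : R) (psi : scalar_field R).
Hypotheses (adm : admissible a) (eig : laplace_eigenspace l psi).
Let v k := poly_op (a k) psi.

Let spsi : smooth psi. Proof. by case: eig. Qed.
Let sv k : smooth (v k). Proof. exact: smooth_poly_op. Qed.
Let divv x : \sum_(j < 3) partial j (v j) x = 0.
Proof. exact: admissible_div_free. Qed.
Let lapv j : laplacian (v j) = - l ^+ 2 \*: v j.
Proof.
rewrite /v laplacian_poly_op // -poly_opZ //; congr poly_op.
apply/funext => x; case: eig => _ _ /(_ x) /(congr1 -%R).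
by rewrite opprK /= /GRing.scale /= mulNr.
Qed.

Lemma beltrami_static_euler : exists p, static_euler (beltrami_field a l psi) p.
Proof.
eexists; apply: (@curl_eigen_static_euler _ l).
- by move=> j; rewrite (component_beltrami a l j spsi); exact: smooth_beltrami sv j.
- by move=> x j; rewrite !component_beltrami //; exact: curl_beltrami.
- move=> x; rewrite /divergence; under eq_bigr do rewrite component_beltrami //.
  exact: div_beltrami.
Qed.

Lemma beltrami_laplacian j x :
  laplacian (component (beltrami_field a l psi) j) x
  = - l ^+ 2 * beltrami_field a l psi x ord0 j.
Proof.
rewrite -[X in _ * X]/(component (beltrami_field a l psi) j x).
by rewrite (component_beltrami a l j spsi) (laplacian_beltrami sv lapv).
Qed.

End Eigen.

End Beltrami.

(** * Inviscid limits *)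

Section Limits.
Variable R : realType.
Implicit Types (psi : scalar_field R) (D : set (R * R)).

#[local] Instance inviscid_filter D : Filter (inviscid D).
Proof. exact: fmap_filter. Qed.

Lemma near_inviscid D (Q : R * R -> Prop) :
  (forall q, D q -> Q q) -> \forall q \near inviscid D, Q q.
Proof.
move=> DQ; apply: (@filterE _ (nbhs (0 : R, 0 : R))) => q; exact: DQ.
Qed.

Lemma inviscidS D D' : D `<=` D' -> inviscid D `=>` inviscid D'.
Proof.
move=> DD' Q; apply: (@filterS _ (nbhs (0 : R, 0 : R))) => q DQ /DD'.
exact: DQ.
Qed.

(** The points (nu, 1/t) = (m s, s) of the path tend to (0, 0) with s; the path
    limit is therefore unique. *)
Lemma inviscid_path_proper (m : R) : 0 < m -> ProperFilter (inviscid (inviscid_path m)).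
Proof.
move=> m0; apply: Build_ProperFilter_ex => Q.
move=> /(@nbhs_ballP _ _ (0 : R, 0 : R))[e /= e0 eP].
pose s := e / 2 / (m + 1).
have m1 : 0 < m + 1 by lra.
have s0 : 0 < s by rewrite !divr_gt0.
have se : s * (m + 1) < e.
  by rewrite /s divfK ?gt_eqF // ltr_pdivrMr // ltr_pMr // ltr1n.
have ms0 : 0 < m * s by rewrite mulr_gt0.
exists (m * s, s^-1); apply: (eP (m * s, s)); last first.
  split; first by split; rewrite //= invr_gt0.
  by rewrite /= mulrC mulfK // gt_eqF.
by split => /=; rewrite /ball /= sub0r normrN gtr0_norm //; nra.
Qed.

Lemma u_nsE a l psi (nu t : R) :
  u_ns a l psi nu t = fun x => expR (- (nu * l ^+ 2 * t)) *: beltrami_field a l psi x.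
Proof.
by apply/funext => x; rewrite /u_ns /beltrami_field scalerDr scalerA mulrC.
Qed.

Lemma u_ns_path a l psi (m : R) x :
  u_ns a l psi q.1 q.2 x @[q --> inviscid (inviscid_path m)]
    --> expR (- (m * l ^+ 2)) *: beltrami_field a l psi x.
Proof.
apply: cvg_near_cst; apply: near_inviscid => -[nu t] [_ /= <-].
by rewrite u_nsE; congr (expR (- _) *: _); ring.
Qed.

Lemma u_eE a l psi (m : R) x : 0 < m ->
  u_e a l psi m x = expR (- (m * l ^+ 2)) *: beltrami_field a l psi x.
Proof.
move=> /inviscid_path_proper m0; apply: cvg_lim; first exact: norm_hausdorff.
exact: u_ns_path.
Qed.

(** For l = 0 the eigenfunction is constant.  The first term of the field has
    the factor l, and the second differentiates the eigenfunction. *)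
Lemma beltrami_field_eq0 a psi x : laplace_eigenspace 0 psi ->
  beltrami_field a 0 psi x = 0.
Proof.
move=> [sf pf ef]; have harm y : laplacian psi y = 0.
  by apply: oppr_inj; rewrite ef expr0n mul0r oppr0.
apply/rowP => j; rewrite !mxE !(periodic_harmonic_cst _ sf pf harm).
by rewrite !poly_op_cst0 mul0r subrr addr0.
Qed.

Lemma u_ns_derive a l psi (nu t : R) x j :
  is_derive t (1 : R) (fun s : R => u_ns a l psi nu s x ord0 j)
    (- (nu * l ^+ 2) * u_ns a l psi nu t x ord0 j).
Proof.
have -> : (fun s : R => u_ns a l psi nu s x ord0 j)
  = (fun s : R => beltrami_field a l psi x ord0 j * expR (- (nu * l ^+ 2) * s)).
  by apply/funext => s; rewrite u_nsE mxE mulrC mulNr.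
set b := beltrami_field a l psi x ord0 j.
rewrite u_nsE mxE -/b.
by apply: is_derive_eq; rewrite /GRing.scale /= !mulNr; ring.
Qed.

End Limits.

Theorem mainTheorem9 (R : realType) (d : measure_display)
    (Omega : measurableType d) (P : probability Omega R)
    (mu : {RV P >-> R}) (mu_gt0 : forall w, 0 < mu w)
    (a : 'I_3 -> mpoly.mpoly 3 R) (a_adm : admissible a)
    (lam : nat -> R) (lam_seq : eigenvalue_sequence lam)
    (n : nat) (psi : scalar_field R) (psi_eig : laplace_eigenspace (lam n) psi) :
  (forall nu : R, 0 < nu ->
     (exists p, navier_stokes nu (u_ns a (lam n) psi nu) p) /\
     forall t, 0 <= t -> periodic2pi (u_ns a (lam n) psi nu t))
  /\
  (forall (w : Omega) (x : 'rV[R]_3),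
     [/\ u_ns a (lam n) psi q.1 q.2 x @[q --> inviscid (inviscid_path (mu w))]
           --> u_e a (lam n) psi (mu w) x,
         u_e a (lam n) psi (mu w) x
         = (lam n * expR (- (mu w * lam n ^+ 2))) *: vec_op a psi x
           + expR (- (mu w * lam n ^+ 2)) *: cross_op a psi x
       & u_e a (lam n) psi (mu w) x
         = lam n *: vec_op a (fun y => expR (- (mu w * lam n ^+ 2)) * psi y) x
           + cross_op a (fun y => expR (- (mu w * lam n ^+ 2)) * psi y) x])
  /\
  ((forall (x : 'rV[R]_3) (j : 'I_3),
      measurable_fun setT (fun w => u_e a (lam n) psi (mu w) x ord0 j)) /\
   (forall w : Omega,
      (exists p, static_euler (u_e a (lam n) psi (mu w)) p) /\
      periodic2pi (u_e a (lam n) psi (mu w))))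
  /\
  (forall x : 'rV[R]_3,
     lam n *: vec_op a psi x + cross_op a psi x <> 0 ->
     ~ exists l : 'rV[R]_3,
         u_ns a (lam n) psi q.1 q.2 x @[q --> inviscid (@quadrant R)] --> l).
Proof.
set l := lam n in psi_eig *; have [spsi ppsi epsi] := psi_eig.
have scaled c := laplace_eigenspaceZ c psi_eig.
have nsE nu t : u_ns a l psi nu t
    = beltrami_field a l (expR (- (nu * l ^+ 2 * t)) \*: psi).
  by rewrite u_nsE beltrami_fieldZ.
have ueE w : u_e a l psi (mu w) = beltrami_field a l (expR (- (mu w * l ^+ 2)) \*: psi).
  by rewrite beltrami_fieldZ //; apply/funext => x; exact: u_eE.
have per c : periodic2pi (beltrami_field a l (c \*: psi)).
  by case: (scaled c) => s p _; exact: periodic_beltrami.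
split; last split; last split.
- move=> nu nu0; split=> [|t _]; last by rewrite nsE.
  have /choice[p pP] : forall t, exists p, static_euler (u_ns a l psi nu t) p.
    by move=> t; rewrite nsE; exact: beltrami_static_euler (scaled _).
  (* the pressure at time t is the one of the static Euler equations *)
  exists p => t _; have [su sp euler divu] := pP t.
  split=> // [x j|x j]; first by case: (u_ns_derive a l psi nu t x j).
  rewrite derive1E (@derive_val _ _ _ _ _ _ _ (u_ns_derive a l psi nu t x j)).
  rewrite -addrA euler addr0 nsE (beltrami_laplacian a (scaled _)).
  ring.
- move=> w x; split.
  + by rewrite u_eE //; exact: u_ns_path.
  + by rewrite u_eE // /beltrami_field scalerDr scalerA mulrC.
  + by rewrite ueE.
- split=> [x j|w]; last first.
    by rewrite ueE; split=> //; exact: beltrami_static_euler (scaled _).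
  have -> : (fun w => u_e a l psi (mu w) x ord0 j)
    = (fun w => expR (- (mu w * l ^+ 2)) * beltrami_field a l psi x ord0 j).
    by apply/funext => w; rewrite u_eE // mxE.
  apply: measurable_funM => //.
  apply: measurableT_comp => //; apply: measurableT_comp => //.
  exact: measurable_funM.
- move=> x; rewrite -/(beltrami_field a l psi x) => W0 [b bP].
  (* a double limit is the limit along every path *)
  have along (m : R) : 0 < m -> expR (- (m * l ^+ 2)) *: beltrami_field a l psi x = b.
    move=> m0; have Fm := inviscid_path_proper m0.
    have bm : u_ns a l psi q.1 q.2 x @[q --> inviscid (inviscid_path m)] --> b.
      apply: cvg_trans bP; apply: cvg_app; apply: inviscidS; exact: subIsetl.
    apply: (cvg_unique _ _ bm); first exact: norm_hausdorff.
    exact: u_ns_path.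
  have : (expR (- (1 * l ^+ 2)) - expR (- (2 * l ^+ 2))) *: beltrami_field a l psi x = 0.
    by rewrite scalerBl !along // subrr.
  move=> /eqP; rewrite scaler_eq0 => /orP[|/eqP //].
  rewrite subr_eq0 => /eqP/expR_inj/oppr_inj l2.
  have /eqP : l ^+ 2 = 0 by lra.
  rewrite sqrf_eq0 => /eqP l0; apply: W0; rewrite l0.
  by apply: beltrami_field_eq0; rewrite -l0.
Qed.
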